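(* Let $D=(V,E)$ be a finite digraph. Then $D$ is an interval nest digraph if and only if $D$ is reflexive and there exists a nest ordering on $V$.
   Context: A digraph $D=(V,E)$ consists of a vertex set $V$ and an arc set $E\subseteq V\times V$ (loops allowed, no multiple arcs); $uv$ denotes the arc from $u$ to $v$. $D$ is reflexive if $uu\in E$ for every $u\in V$. $\mathcal{S}(E)$ denotes the set of symmetric arcs: $uv\in\mathcal{S}(E)$ means $uv\in E$ and $vu\in E$. $D$ is an interval nest digraph if there is a family $\{I_u,J_u\}_{u\in V}$ of (nonempty, bounded) closed intervals of the real line (single points allowed) such that $J_u\subseteq I_u$ for all $u\in V$ and, for all $u,v\in V$ (not necessarily distinct), $uv\in E$ if and only if $I_u\cap J_v\neq\emptyset$. A total ordering $\leq$ of the vertex set of a reflexive digraph $D=(V,E)$ is a nest ordering if for all $u\leq v\leq w\leq z$ in $V$ (repetitions allowed) all of the following hold: (i) If $uw,uz\in E$, then either $uv\in E$ or $vw,vz,wz\in\mathcal{S}(E)$. If $zu,zv\in E$, then either $zw\in E$ or $wu,vu,wv\in\mathcal{S}(E)$. (ii) If $uz,vw\in E$, then either $uw\in E$ or $vz\in E$. If $zu,wv\in E$, then either $zv\in E$ or $wu\in E$. (iii) If $uw,vz\in E$, then either $vw\in E$ or $uz\in E$. If $zv,wu\in E$, then either $zu\in E$ or $wv\in E$. (''Either ... or'' is inclusive.) *)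

(* Defs.v *)
From mathcomp Require Import all_boot all_order all_algebra.
From mathcomp Require Import boolp classical_sets set_interval reals.

Set Implicit Arguments.
Unset Strict Implicit.
Unset Printing Implicit Defensive.

Import Order.TTheory GRing.Theory Num.Theory.

Local Open Scope ring_scope.
Local Open Scope classical_set_scope.

(* A finite digraph is a finite type V of vertices with a relation E : rel V,
   E u v meaning that uv is an arc. It is reflexive when [reflexive E]. *)

Definition symmetric_arc (V : Type) (E : rel V) : rel V :=
  fun u v => E u v && E v u.

Definition closed_interval (R : realType) (A : set R) : Prop :=
  exists a b : R, a <= b /\ A = `[a, b].

Definition interval_nest_digraph (R : realType) (V : Type) (E : rel V) : Prop :=
  exists I J : V -> set R,
    [/\ forall u, closed_interval (I u),
        forall u, closed_interval (J u),
        forall u, J u `<=` I u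
      & forall u v, E u v <-> I u `&` J v !=set0].

Definition total_ordering (V : Type) (le : rel V) : Prop :=
  [/\ reflexive le, antisymmetric le, transitive le & total le].

Definition nest_ordering (V : Type) (E le : rel V) : Prop :=
  total_ordering le /\
  forall u v w z : V, le u v -> le v w -> le w z ->
  [/\ (E u w /\ E u z ->
         E u v \/ [/\ symmetric_arc E v w, symmetric_arc E v z
                    & symmetric_arc E w z])
      /\ (E z u /\ E z v ->
         E z w \/ [/\ symmetric_arc E w u, symmetric_arc E v u
                    & symmetric_arc E w v]),
      (E u z /\ E v w -> E u w \/ E v z)
      /\ (E z u /\ E w v -> E z v \/ E w u)
    & (E u w /\ E v z -> E v w \/ E u z)
      /\ (E z v /\ E w u -> E z u \/ E w v)].

(* Main.v *)
Require Import Defs.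
From mathcomp Require Import all_boot all_order all_algebra.
From mathcomp Require Import boolp classical_sets set_interval reals.
From mathcomp Require Import lra zify.

(** Write [I_u = [a u, b u]] and [J_u = [c u, d u]], so that [uv] is an arc iff
    [a u <= d v] and [c v <= b u].

    From intervals to orderings: sort the vertices by [c]. For [u <= v], a
    missing arc [uv] then means [b u < c v], and a missing arc [vu] means
    [d u < a v]; the nest conditions follow.

    From orderings to intervals: one needs [b u < c v] whenever [u <= v] and
    [uv] is not an arc, and [d u < a v] whenever [u <= v] and [vu] is not an
    arc. The nest conditions make each of these two relations a Ferrers
    relation, so that the sets [B v = {u | u <= v, uv not an arc}] are nested,
    as are the sets [A v = {u | u <= v, vu not an arc}]. The endpoints are pairs
    ordered lexicographically: the first components, generated by [#|B v|] for
    [c v], settle the constraints between [b] and [c], and the second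
    components, generated by [#|A v|] for [a v], those between [d] and [a]. *)

Set Implicit Arguments.
Unset Strict Implicit.
Unset Printing Implicit Defensive.

Import Order.TTheory GRing.Theory Num.Theory.

Local Open Scope ring_scope.
Local Open Scope classical_set_scope.

(** * Intervals and their endpoints *)

Lemma itv_meets (R : realType) (a b c d : R) : a <= b -> c <= d ->
  `[a, b] `&` `[c, d] !=set0 <-> (a <= d) && (c <= b).
Proof.
move=> ab cd; split=> [[x []]|/andP[ad cb]].
  rewrite /= !in_itv /= => /andP[ax xb] /andP[cx xd].
  by rewrite (le_trans ax xd) (le_trans cx xb).
exists (Num.max a c); split; rewrite /= in_itv /= !ge_max !le_max !lexx ?orbT /=.
- by rewrite ab.
- by rewrite ad.
Qed.

Lemma interval_nest_endpoints (R : realType) (V : Type) (E : rel V) :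
  interval_nest_digraph R E <->
  exists a b c d : V -> R,
    [/\ forall u, a u <= c u, forall u, c u <= d u, forall u, d u <= b u
      & forall u v, E u v = (a u <= d v) && (c v <= b u)].
Proof.
split=> [[I [J [clI clJ JI EIJ]]]|[a [b [c [d [ac cd db Eabcd]]]]]].
  have [a /choice[b Iab]] := choice clI; have [c /choice[d Jcd]] := choice clJ.
  have JsubI u : a u <= c u /\ d u <= b u.
    have [ab IE] := Iab u; have [cd JE] := Jcd u.
    have := JI u; rewrite IE JE => sub.
    have /sub : `[c u, d u] (c u) by rewrite /= in_itv /= lexx.
    have /sub : `[c u, d u] (d u) by rewrite /= in_itv /= lexx cd.
    by rewrite /= !in_itv /= => /andP[_ ->] /andP[-> _].
  exists a, b, c, d; split=> [u|u|u|u v].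
  - exact: (JsubI u).1.
  - exact: (Jcd u).1.
  - exact: (JsubI u).2.
  - have [ab IE] := Iab u; have [cd JE] := Jcd v.
    apply/idP/idP; first by move=> /EIJ; rewrite IE JE => /itv_meets; apply.
    by move=> H; apply/EIJ; rewrite IE JE; apply/itv_meets.
have ab u : a u <= b u by exact: le_trans (le_trans (ac u) (cd u)) (db u).
exists (fun u => `[a u, b u]), (fun u => `[c u, d u]); split=> [u|u|u x|u v].
- by exists (a u), (b u).
- by exists (c u), (d u).
- rewrite /= !in_itv /= => /andP[cx xd].
  by rewrite (le_trans (ac u) cx) (le_trans xd (db u)).
- by rewrite Eabcd; split=> /itv_meets; apply.
Qed.

(** * From intervals to a nest ordering *)

Lemma total_ordering_of_key (R : realType) (V : finType) (c : V -> R) :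
  exists2 le : rel V, total_ordering le & forall u v, le u v -> c u <= c v.
Proof.
exists (fun u v => (c u < c v) ||
                   ((c u == c v) && (enum_rank u <= enum_rank v)%N)); last first.
  by move=> u v /orP[/ltW//|/andP[/eqP-> _]].
split.
- by move=> u; rewrite eqxx leqnn orbT.
- move=> u v; case: (ltgtP (c u) (c v)) => //= _ H.
  by apply/enum_rank_inj/val_inj/anti_leq.
- move=> v u w /orP[uv|/andP[/eqP uv ruv]] /orP[vw|/andP[/eqP vw rvw]].
  + by rewrite (lt_trans uv vw).
  + by rewrite -vw uv.
  + by rewrite uv vw.
  + by rewrite uv vw eqxx (leq_trans ruv rvw) orbT.
- by move=> u v; case: (ltgtP (c u) (c v)) => //= _; exact: leq_total.
Qed.

Lemma endpoints_nest_ordering (R : realType) (V : finType) (E le : rel V)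
    (a b c d : V -> R) :
  (forall u, a u <= c u) -> (forall u, c u <= d u) -> (forall u, d u <= b u) ->
  (forall u v, E u v = (a u <= d v) && (c v <= b u)) ->
  total_ordering le -> (forall u v, le u v -> c u <= c v) ->
  nest_ordering E le.
Proof.
move=> ac cd db Eabcd le_tot le_c; split=> // u v w z /le_c uv /le_c vw /le_c wz.
have := (ac u, ac v, ac w, ac z, cd u, cd v).
have := (cd w, cd z, db u, db v, db w, db z).
move=> [[[[[cdw cdz] dbu] dbv] dbw] dbz] [[[[[acu acv] acw] acz] cdu] cdv].
rewrite /symmetric_arc !Eabcd.
split; split=> -[/andP[H1 H2] /andP[H3 H4]].
- by left; apply/andP; split; lra.
- case: (lerP (a z) (d w)) => zw; first by left; apply/andP; split; lra.
  (* Here [d w < a z], while [a z] is at most [d u] and [d v]; so [[c w, d w]] lies in [[c u, d u]]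
     and in [[c v, d v]], which makes all three arcs symmetric. *)
  by right; split; apply/andP; split; apply/andP; split; lra.
- case: (lerP (c w) (b u)) => uw; [left|right]; apply/andP; split; lra.
- case: (lerP (a z) (d v)) => zv; [left|right]; apply/andP; split; lra.
- case: (lerP (c w) (b v)) => uw; [left|right]; apply/andP; split; lra.
- case: (lerP (a z) (d u)) => zv; [left|right]; apply/andP; split; lra.
Qed.

(** * Gaps of a nest ordering *)

Definition forward_gap (V : Type) (E le : rel V) : rel V :=
  fun u v => le u v && ~~ E u v.

(** The two halves of each condition trade places. A backward gap is a [forward_gap] of the reversed
    order, so [gap_ferrers] also serves backward gaps. *)
Lemma nest_ordering_rev (V : Type) (E le : rel V) :
  nest_ordering E le -> nest_ordering E (fun u v => le v u).
Proof.
case=> -[rle ale tle totle] nest; split.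
  split=> //.
  - by move=> u v; rewrite andbC; exact: ale.
  - by move=> v u w vu wv; exact: tle wv vu.
move=> u v w z vu wv zw.
have [[i1 i2] [ii1 ii2] [iii1 iii2]] := nest z w v u zw wv vu.
have symC x y : symmetric_arc E x y = symmetric_arc E y x by exact: andbC.
split; split=> -[H1 H2].
- by have [|[vz wz vw]] := i2 (conj H2 H1); [left|right; split; rewrite // symC].
- by have [|[vw uv uw]] := i1 (conj H2 H1); [left|right; split; rewrite // symC].
- exact: ii2 (conj H1 H2).
- exact: ii1 (conj H1 H2).
- by have [] := iii2 (conj H1 H2); [right|left].
- by have [] := iii1 (conj H1 H2); [right|left].
Qed.

Section NestOrdering.
Variables (V : Type) (E le : rel V).
Hypothesis nest : nest_ordering E le.
Local Notation gap := (forward_gap E le).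

Lemma nest_triple u v w : le u v -> le v w -> E u w ->
  E u v \/ symmetric_arc E v w.
Proof.
move=> uv vw Euw; have [[rle _ _ _] /(_ u v w w uv vw (rle w))[[i1 _] _ _]] := nest.
by have [|[]] := i1 (conj Euw Euw); [left|right].
Qed.

Lemma nest_triple_rev u v w : le u v -> le v w -> E w u ->
  E w v \/ symmetric_arc E v u.
Proof.
move=> uv vw Ewu; have [[rle _ _ _] /(_ u u v w (rle u) uv vw)[[_ i2] _ _]] := nest.
by have [|[]] := i2 (conj Ewu Ewu); [left|right].
Qed.

(** Condition (i) is used twice, for [uw] and then for [uv]; each time the alternative would make
    [wz] an arc. *)
Lemma nest_between u v w z : le u v -> le v w -> le w z -> E u z -> ~~ E w z ->
  E u v.
Proof.
move=> uv vw wz Euz nEwz; have [[_ _ tle _] /(_ u v w z uv vw wz)[[i1 _] _ _]] := nest.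
have [Euw|/andP[]] := nest_triple (tle _ _ _ uv vw) wz Euz.
  by have [//|[_ _ /andP[]]] := i1 (conj Euw Euz); rewrite (negbTE nEwz).
by rewrite (negbTE nEwz).
Qed.

Lemma gap_ferrers u v w x : gap u v -> E u w -> gap x w -> gap x v.
Proof.
have [[_ _ tle totle] cond] := nest.
move=> /andP[uv nEuv] Euw /andP[xw nExw]; rewrite /forward_gap.
have [vx|xv] := orP (totle v x).
  by rewrite (nest_between uv vx xw Euw nExw) in nEuv.
rewrite xv /=; apply/negP => Exv.
have [wu|uw] := orP (totle w u).
  by rewrite (nest_between xw wu uv Exv nEuv) in nExw.
(* Both [u] and [x] now precede [v] and [w]. If the arcs [uw] and [xv] are nested, condition (ii)
   applies; if they cross, condition (iii). *)
have absurd : ~ (E u v \/ E x w) by case; apply/negP.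
have [ux|xu] := orP (totle u x); have [vw|wv] := orP (totle v w); apply: absurd.
- by have [_ [H _] _] := cond _ _ _ _ ux xv vw; exact: H.
- by have [_ _ [H _]] := cond _ _ _ _ ux xw wv; case: (H (conj Euw Exv)); auto.
- by have [_ _ [H _]] := cond _ _ _ _ xu uv vw; case: (H (conj Exv Euw)); auto.
- by have [_ [H _] _] := cond _ _ _ _ xu uw wv; case: (H (conj Exv Euw)); auto.
Qed.

Lemma gap_shift u v w : gap u v -> le v w -> ~~ E w v -> gap u w.
Proof.
have [[_ _ tle _] _] := nest.
move=> /andP[uv nEuv] vw nEwv; rewrite /forward_gap (tle _ _ _ uv vw) /=.
apply/negP=> /(nest_triple uv vw)[|/andP[_]]; exact/negP.
Qed.

(** The endpoints must satisfy [c x <= d x < a y <= d u <= b u < c v], so [B x] has to lie inside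
    [B v]. *)
Lemma gap_shift_arc u v x y z : le x y -> ~~ E y x -> E y u -> gap u v -> gap z x ->
  gap z v.
Proof.
have [[_ _ tle totle] _] := nest.
move=> xy nEyx Eyu uv zx; have [Eux|nEux] := boolP (E u x).
  exact: gap_ferrers uv Eux zx.
have [ux|xu] := orP (totle u x).
  have [|/andP[_]] := nest_triple_rev ux xy Eyu.
  - by rewrite (negbTE nEyx).
  - by rewrite (negbTE nEux).
have [lezx nEzx] := andP zx; have [leuv nEuv] := andP uv.
rewrite /forward_gap (tle _ _ _ lezx (tle _ _ _ xu leuv)) /=; apply/negP => Ezv.
by rewrite (nest_between lezx xu leuv Ezv nEuv) in nEzx.
Qed.

End NestOrdering.

(** * Endpoints from the sizes of gap sets *)

Section Endpoints.
Variables (V : finType) (E le : rel V).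
Hypotheses (Erefl : reflexive E) (nest : nest_ordering E le).

Let A (v : V) : {set V} := [set u | forward_gap (fun x y => E y x) le u v].
Let B (v : V) : {set V} := [set u | forward_gap E le u v].

(* [code p q] stands for the pair [(p, q)]. Starting from [#|B v|] for [c v],
   the first components [pa], [pd], [pb] are the least that satisfy
   [d u <= a v] for [u \in A v], [a u <= d v] and [c v <= b u] for every arc [uv],
   and [c v <= d v <= b v]. *)
Let pa v := (\max_(u in A v) #|B u|)%N.
Let pd u := maxn #|B u| (\max_(v | E v u) pa v).
Let pb u := maxn (pd u) (\max_(v | E u v) #|B v|).
Let qd u := (\max_(v | E v u) #|A v|)%N.
Let code p q := (p * #|V|.+1 + q)%N.

Let A_proper u v w : u \in A v -> E w u -> A w \proper A v.
Proof.
move=> uAv Ewu; apply/properP; split; last first.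
  by exists u; rewrite // inE /forward_gap Ewu andbF.
apply/fintype.subsetP => x; move: uAv; rewrite !inE => uv xw.
exact: (gap_ferrers (nest_ordering_rev nest) xw Ewu uv).
Qed.

(** Yields [pa v <= #|B v|], needed for [a v <= c v]. *)
Let B_subset u v : u \in A v -> B u \subset B v.
Proof.
rewrite inE => /andP[uv nEvu]; apply/fintype.subsetP => x; rewrite !inE => xu.
exact: (gap_shift nest xu).
Qed.

Let B_proper u v w : u \in B v -> E u w -> B w \proper B v.
Proof.
move=> uBv Euw; apply/properP; split; last first.
  by exists u; rewrite // inE /forward_gap Euw andbF.
apply/fintype.subsetP => x; move: uBv; rewrite !inE => uv; exact: (gap_ferrers nest uv).
Qed.

Let AB_proper u v x y : x \in A y -> E y u -> u \in B v -> B x \proper B v.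
Proof.
rewrite inE => /andP[xy nEyx] Eyu uBv; apply/properP; split.
  apply/fintype.subsetP => z; move: uBv; rewrite !inE => uv.
  exact: (gap_shift_arc nest xy nEyx Eyu uv).
exists u => //; rewrite inE; apply/negP => /andP[ux nEux].
have [|/andP[_]] := nest_triple_rev nest ux xy Eyu.
- by rewrite (negbTE nEyx).
- by rewrite (negbTE nEux).
Qed.

Let bigmax_ltn (P : pred V) (F : V -> nat) m : (0 < m)%N ->
  (forall i, P i -> (F i < m)%N) -> (\max_(i | P i) F i < m)%N.
Proof. by case: m => // m _ H; apply/bigmax_leqP => i /H. Qed.

Let pa_le v : (pa v <= #|B v|)%N.
Proof. by apply/bigmax_leqP => u /B_subset/subset_leq_card. Qed.

Let pd_le_pa u v : u \in A v -> (pd u <= pa v)%N.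
Proof.
move=> uAv; rewrite geq_max (bigop.bigmax_sup u) //=; apply/bigmax_leqP => w Ewu.
apply/bigmax_leqP => x xAw; apply: (bigop.bigmax_sup x) => //.
exact: (fintype.subsetP (proper_sub (A_proper uAv Ewu))).
Qed.

Let qd_lt u v : u \in A v -> (qd u < #|A v|)%N.
Proof.
move=> uAv; apply: bigmax_ltn; first by apply/card_gt0P; exists u.
by move=> w Ewu; exact/proper_card/(A_proper uAv Ewu).
Qed.

Let pb_lt u v : u \in B v -> (pb u < #|B v|)%N.
Proof.
move=> uBv; have B0 : (0 < #|B v|)%N by apply/card_gt0P; exists u.
rewrite !gtn_max; apply/andP; split; first apply/andP; first split.
- exact/proper_card/(B_proper uBv).
- apply: bigmax_ltn => // y Eyu; apply: bigmax_ltn => // x xAy.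
  exact/proper_card/(AB_proper xAy Eyu).
- by apply: bigmax_ltn => // w Euw; exact/proper_card/(B_proper uBv).
Qed.

Let code_le p q p' q' : (p <= p')%N -> (q <= q')%N -> (code p q <= code p' q')%N.
Proof. by move=> pp' qq'; rewrite leq_add // leq_mul. Qed.

Lemma nest_ordering_endpoints :
  exists a b c d : V -> nat,
    [/\ forall u, (a u <= c u)%N, forall u, (c u <= d u)%N,
        forall u, (d u <= b u)%N
      & forall u v, E u v = (a u <= d v)%N && (c v <= b u)%N].
Proof.
have [[_ _ _ totle] _] := nest.
have qd_max u : (qd u <= #|V|)%N by apply/bigmax_leqP => v _; exact: max_card.
(* First components alone separate [b] from [c], so [b] can take the largest second component. *)
exists (fun v => code (pa v) #|A v|), (fun v => code (pb v) #|V|),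
  (fun v => code #|B v| #|A v|), (fun v => code (pd v) (qd v)); split.
- by move=> v; exact: code_le.
(* Reflexivity puts [v] among the indices of the maximum [qd v]. *)
- by move=> v; apply: code_le; [exact: leq_maxl|exact: (bigop.bigmax_sup v)].
- by move=> v; apply: code_le => //; exact: leq_maxl.
move=> u v; apply/idP/andP => [Euv|[ad cb]].
  split; apply: code_le.
  - by rewrite leq_max (bigop.bigmax_sup u) ?orbT.
  - exact: (bigop.bigmax_sup u).
  - by rewrite leq_max (bigop.bigmax_sup v) ?orbT.
  - exact: max_card.
apply/negPn/negP => nEuv; have [uv|vu] := orP (totle u v).
  have /pb_lt lt_pb : u \in B v by rewrite inE /forward_gap uv.
  (* One unit in the first component is worth [#|V|.+1], more than the second component [#|V|] of
     [b u]. *)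
  by move: cb; rewrite /code; nia.
have vAu : v \in A u by rewrite inE /forward_gap vu.
(* First components may tie here; the second ones decide. *)
have := pd_le_pa vAu; have := qd_lt vAu.
by move: ad; rewrite /code; nia.
Qed.

End Endpoints.

Theorem theorem1 (R : realType) (V : finType) (E : rel V) :
  interval_nest_digraph R E <->
  reflexive E /\ exists le : rel V, nest_ordering E le.
Proof.
split=> [/interval_nest_endpoints[a [b [c [d [ac cd db Eabcd]]]]]|[Er [le nest]]].
  split=> [u|].
    by rewrite Eabcd (le_trans (ac u) (cd u)) (le_trans (cd u) (db u)).
  have [le le_tot le_c] := total_ordering_of_key c.
  by exists le; exact: (endpoints_nest_ordering ac cd db Eabcd).
apply/interval_nest_endpoints.
have [a [b [c [d [ac cd db Eabcd]]]]] := nest_ordering_endpoints Er nest.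
exists (fun u => (a u)%:R), (fun u => (b u)%:R), (fun u => (c u)%:R),
  (fun u => (d u)%:R).
by split=> [u|u|u|u v]; rewrite !ler_nat.
Qed.
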